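(* The number $N$ of all distinct fuzzy subgroups with respect to $\approx$ of the elementary abelian $2$-group $\mathbb{Z}_2^2=\mathbb{Z}_2\times\mathbb{Z}_2$ (that is, the number of equivalence classes of $FL(\mathbb{Z}_2^2)$ modulo $\approx$) is $$N=\frac16\,(8+3\cdot 4+2\cdot 2)=4.$$
   Context: Let $G$ be a finite group. A fuzzy subgroup of $G$ is a function $\mu:G\to[0,1]$ with $\mu(xy)\ge\min\{\mu(x),\mu(y)\}$ and $\mu(x^{-1})\ge\mu(x)$ for all $x,y\in G$; $FL(G)$ denotes the set of all fuzzy subgroups of $G$. For $\alpha\in[0,1]$ put ${}_\mu G_\alpha=\{x\in G\mid \mu(x)\ge\alpha\}$. If $\mu(G)=\{\alpha_1,\dots,\alpha_r\}$ with $\alpha_1>\alpha_2>\dots>\alpha_r$, then $\mu$ determines the chain of subgroups $\mathcal{C}_\mu:\ {}_\mu G_{\alpha_1}\subset{}_\mu G_{\alpha_2}\subset\dots\subset{}_\mu G_{\alpha_r}=G$ (strict inclusions). The relation $\approx$ on $FL(G)$: $\mu\approx\eta$ iff there exists $f\in\mathrm{Aut}(G)$ with $f(\mathcal{C}_\eta)=\mathcal{C}_\mu$, i.e. the two chains have the same number of terms and $f$ maps the $i$-th term of $\mathcal{C}_\eta$ onto the $i$-th term of $\mathcal{C}_\mu$ for every $i$. The number of distinct fuzzy subgroups of $G$ with respect to $\approx$ is the number of $\approx$-classes of $FL(G)$; equivalently, it is the number of orbits of $\mathrm{Aut}(G)$ acting termwise on the set of strictly increasing chains $H_1\subset H_2\subset\dots\subset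 H_m=G$ ($m\ge1$) of subgroups of $G$ ending in $G$ (the first term $H_1$ need not be trivial). *)

(* Defs.v *)
From mathcomp Require Import all_boot all_order all_algebra all_fingroup.
From mathcomp Require Import boolp classical_sets functions cardinality reals.

Set Implicit Arguments.
Unset Strict Implicit.
Unset Printing Implicit Defensive.

Import Order.TTheory GRing.Theory Num.Theory.
Local Open Scope ring_scope.
Local Open Scope classical_set_scope.

(* The finite group G is the whole finGroupType gT. *)

Definition fuzzy_subgroup (R : realType) (gT : finGroupType)
    (mu : gT -> R) : Prop :=
  [/\ forall x, 0 <= mu x <= 1,
      forall x y, Num.min (mu x) (mu y) <= mu (x * y)%g
    & forall x, mu x <= mu x^-1%g].

Definition FL (R : realType) (gT : finGroupType) : set (gT -> R) :=
  [set mu | fuzzy_subgroup mu].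
Arguments FL : clear implicits.

Definition level_set (R : realType) (gT : finGroupType)
    (mu : gT -> R) (alpha : R) : {set gT} := [set x | alpha <= mu x]%SET.

Definition levels (R : realType) (gT : finGroupType) (mu : gT -> R) : seq R :=
  sort (fun a b => b <= a) (undup (codom mu)).

(* As levels mu is strictly decreasing, this sequence is strictly increasing
   for inclusion, and it ends with the whole group. *)
Definition level_chain (R : realType) (gT : finGroupType)
    (mu : gT -> R) : seq {set gT} :=
  [seq level_set mu alpha | alpha <- levels mu].

(* Equality of the two sequences encodes both equality of the lengths and
   termwise equality. *)
Definition fuzzy_approx (R : realType) (gT : finGroupType)
    (mu eta : gT -> R) : Prop :=
  exists2 f : {perm gT}, f \in Aut [set: gT]%SET
    & [seq f @: (H : {set gT}) | H <- level_chain eta]%SET = level_chain mu.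

Lemma fuzzy_approx_refl (R : realType) (gT : finGroupType) (mu : gT -> R) :
  fuzzy_approx mu mu.
Proof.
exists 1%g; first exact: group1.
rewrite -[RHS]map_id; apply: eq_map => H.
by rewrite (eq_imset (g := id) H (@perm1 gT)) imset_id.
Qed.

Lemma fuzzy_approx_sym (R : realType) (gT : finGroupType) (mu eta : gT -> R) :
  fuzzy_approx mu eta -> fuzzy_approx eta mu.
Proof.
case=> f fA fE; exists f^-1%g; first by rewrite groupV.
rewrite -fE -map_comp -[RHS]map_id; apply: eq_map => H /=.
by rewrite -imset_comp (eq_imset (g := id) H (permK f)) imset_id.
Qed.

Lemma fuzzy_approx_trans (R : realType) (gT : finGroupType)
    (mu eta nu : gT -> R) :
  fuzzy_approx mu eta -> fuzzy_approx eta nu -> fuzzy_approx mu nu.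
Proof.
case=> f fA fE [g gA gE]; exists (g * f)%g; first by rewrite groupM.
rewrite -fE -gE -map_comp; apply: eq_map => H /=.
by rewrite -imset_comp; apply: eq_imset => x /=; rewrite permM.
Qed.

Definition fuzzy_class (R : realType) (gT : finGroupType)
    (mu : gT -> R) : set (gT -> R) :=
  [set eta | FL R gT eta /\ fuzzy_approx mu eta].

Definition fuzzy_classes (R : realType) (gT : finGroupType) :
    set (set (gT -> R)) :=
  [set fuzzy_class mu | mu in FL R gT].
Arguments fuzzy_classes : clear implicits.

(* Main.v *)
Require Import Defs.
From mathcomp Require Import all_boot all_order all_algebra all_fingroup.
From mathcomp Require Import boolp classical_sets functions cardinality reals.

Set Implicit Arguments.
Unset Strict Implicit.
Unset Printing Implicit Defensive.

Import Order.TTheory GRing.Theory Num.Theory.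
Local Open Scope ring_scope.
Local Open Scope classical_set_scope.
Local Open Scope card_scope.

(** The orders of the terms of a level chain form a strictly increasing
    sequence of divisors of 4 ending in 4.  In the Klein four-group, subgroups
    of order 1 and 4 are unique, and any two involutions are exchanged by an
    automorphism, so this sequence of orders is a complete invariant.  It is
    determined by whether it contains 1 and whether it contains 2, and the four
    possibilities all occur. *)

(** * Orders of the terms of a level chain, in any finite group *)

Section LevelChains.
Variables (R : realType) (gT : finGroupType).
Implicit Types (mu eta : gT -> R) (H K : {set gT}).

Definition chain_orders mu : seq nat := [seq #|pred_of_set H| | H <- level_chain mu].

Lemma mem_levels mu a : (a \in levels mu) = (a \in codom mu).
Proof. by rewrite mem_sort mem_undup. Qed.

Lemma level_chainP mu H :
  reflect (exists x, H = level_set mu (mu x)) (H \in level_chain mu).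
Proof.
apply: (iffP mapP) => [[a]|[x ->]].
  by rewrite mem_levels => /codomP[x ->] ->; exists x.
by exists (mu x); rewrite // mem_levels codom_f.
Qed.

Lemma chain_ordersP mu n :
  reflect (exists x, #|level_set mu (mu x)| = n) (n \in chain_orders mu).
Proof.
apply: (iffP mapP) => [[H /level_chainP[x ->] ->]|[x <-]]; first by exists x.
by exists (level_set mu (mu x)) => //; apply/level_chainP; exists x.
Qed.

Lemma level_setS mu (a b : R) : a <= b -> level_set mu b \subset level_set mu a.
Proof. by move=> ab; apply/fintype.subsetP => x; rewrite !inE; apply: le_trans. Qed.

(** Level sets are nested, and nested finite sets of equal cardinality coincide. *)
Lemma level_chain_card_inj mu :
  {in level_chain mu &, injective (fun H => #|pred_of_set H|)}.
Proof.
move=> _ _ /level_chainP[x ->] /level_chainP[y ->] /= eq_card.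
case: (leP (mu x) (mu y)) => [xy|/ltW yx]; apply/eqP.
  by rewrite eq_sym eqEcard level_setS //= eq_card.
by rewrite eqEcard level_setS //= eq_card.
Qed.

Lemma chain_orders_sorted mu : sorted ltn (chain_orders mu).
Proof.
rewrite /chain_orders /level_chain -map_comp sorted_map.
have : sorted (fun a b : R => b < a) (levels mu).
  have -> : (fun a b : R => b < a) = (fun a b => (a != b) && (b <= a)).
    by apply/funext => a; apply/funext => b; rewrite lt_neqAle eq_sym.
  have: sorted (fun a b : R => b <= a) (levels mu).
    by apply: sort_sorted => a b; exact: ge_total.
  have: uniq (levels mu) by rewrite sort_uniq undup_uniq.
  elim: (levels mu) => // a [//|b s] IHs /= /andP[+ us] /andP[-> ss].
  by rewrite inE negb_or => /andP[-> _]; apply: IHs.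
apply: (@sub_in_sorted _ [in levels mu]); last exact/allP.
(* Strict inclusion uses that [b] is an attained value: a point [x] with value [b] lies in the level
   set of [b] but not in that of the larger [a]. *)
move=> a b _ b_lev; have /codomP[x ->] : b \in codom mu by rewrite -mem_levels.
move=> lt_xa /=.
apply: proper_card; rewrite properE level_setS ?ltW //=.
by apply/fintype.subsetPn; exists x; rewrite !inE // -ltNge.
Qed.

Lemma level_chain_group mu H :
  fuzzy_subgroup mu -> H \in level_chain mu -> group_set H.
Proof.
case=> _ muM muV /level_chainP[x ->]; apply/group_setP; split=> [|y z].
  (* Writing the identity as [x * x^-1] shows that [mu] takes its maximum there. *)
  by rewrite inE -(mulgV x); apply: le_trans (muM _ _); rewrite le_min lexx muV.
by rewrite !inE => xy xz; apply: le_trans (muM _ _); rewrite le_min xy xz.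
Qed.

Lemma chain_orders_dvd mu n :
  fuzzy_subgroup mu -> n \in chain_orders mu -> (n %| #|gT|)%N.
Proof.
move=> mu_fuzzy /mapP[H /(level_chain_group mu_fuzzy) gH ->].
by rewrite -cardsT -[H]/(gval (Group gH)) cardSg // finset.subsetT.
Qed.

(** The level set at the minimum of [mu] is the whole group. *)
Lemma card_in_chain_orders mu : #|gT| \in chain_orders mu.
Proof.
apply/chain_ordersP.
case: (@arg_minP _ _ _ (1%g : gT) predT mu isT) => x _ min_x.
exists x; rewrite -cardsT; congr #|pred_of_set _|.
by apply/setP => y; rewrite !inE min_x.
Qed.

Lemma fuzzy_approx_orders mu eta :
  fuzzy_approx mu eta -> chain_orders mu = chain_orders eta.
Proof.
case=> f _ fE; rewrite /chain_orders -fE -map_comp.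
by apply: eq_map => H /=; rewrite card_imset //; apply: perm_inj.
Qed.

End LevelChains.

(** * Subgroups and automorphisms of the Klein four-group *)

Local Notation V4 := ('Z_2 * 'Z_2)%type.

Definition V4_elements : seq V4 := [:: (0, 0); (0, 1); (1, 0); (1, 1)].

Lemma mem_V4_elements (x : V4) : x \in V4_elements.
Proof. by case: x => [[[|[|//]] ?] [[|[|//]] ?]]. Qed.

Lemma card_V4_set (A : {set V4}) : #|A| = count (mem A) V4_elements.
Proof.
rewrite cardE -size_filter; apply: perm_size; apply: uniq_perm.
- exact: enum_uniq.
- exact: filter_uniq.
- by move=> x; rewrite mem_enum mem_filter mem_V4_elements andbT.
Qed.

Lemma card_V4 : #|{: V4}| = 4%N.
Proof. by rewrite card_prod !card_ord. Qed.

(** The product of two distinct involutions is the third one, so every permutation fixing the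
    identity is an automorphism. *)
Lemma V4_swap_Aut (h k : V4) :
  h != 1%g -> k != 1%g -> tperm h k \in Aut [set: V4]%SET.
Proof.
move=> h1 k1; rewrite inE; apply/andP; split.
  by apply/fintype.subsetP => x; rewrite !inE.
apply/morphicP => x y _ _; rewrite !permE /=.
(* [sw] is the transposition in a form that evaluates, so multiplicativity is checked over all
   quadruples of elements. *)
pose sw (h k x : V4) := if x == h then k else if x == k then h else x.
have /allP/(_ h (mem_V4_elements h))/allP/(_ k (mem_V4_elements k)) :
  all (fun h => all (fun k => (h != 1%g) ==> (k != 1%g) ==> 
    all (fun x => all (fun y => sw h k (x * y)%g == (sw h k x * sw h k y)%g)
      V4_elements) V4_elements) V4_elements) V4_elements by [].
rewrite h1 k1 => /allP/(_ x (mem_V4_elements x))/allP/(_ y (mem_V4_elements y)).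
by move/eqP.
Qed.

(** A standard subgroup of order [n] for [n] = 1, 2, 4 and nontrivial [h]; the whole group is the
    default for all other [n]. *)
Definition V4_subgroup (h : V4) (n : nat) : {set V4} :=
  if n == 1%N then [set 1%g]%SET else if n == 2%N then [set 1%g; h]%SET else [set: V4]%SET.

Lemma V4_subgroup_swap (h k : V4) n : h != 1%g -> k != 1%g ->
  (tperm h k @: V4_subgroup h n)%SET = V4_subgroup k n.
Proof.
move=> h1 k1; have fix1 : tperm h k 1%g = 1%g by rewrite tpermD.
rewrite /V4_subgroup; case: ifP => _; first by rewrite imset_set1 fix1.
case: ifP => _; first by rewrite imsetU1 imset_set1 fix1 tpermL.
by apply/eqP; rewrite eqEcard finset.subsetT card_imset //=; apply: perm_inj.
Qed.

Lemma V4_order2 (H : {set V4}) : group_set H -> #|H| = 2%N ->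
  exists2 h, h != 1%g & H = [set 1%g; h]%SET.
Proof.
move=> /group_setP[H1 _] /eqP/cards2P[x [y [xy HE]]].
move: H1; rewrite HE !inE => /orP[]/eqP e1; rewrite -{}e1 in xy *.
  by exists y; rewrite // eq_sym.
by exists x; rewrite // finset.setUC.
Qed.

(** * Classification of the fuzzy subgroups of the Klein four-group *)

Section V4FuzzySubgroups.
Variable R : realType.
Implicit Types mu eta : V4 -> R.

(** Both sides are strictly increasing, so it suffices to compare members; by Lagrange these are
    divisors of 4. *)
Lemma V4_chain_orders mu : fuzzy_subgroup mu ->
  chain_orders mu = [seq n <- [:: 1; 2; 4]%N | n \in chain_orders mu].
Proof.
move=> mu_fuzzy; apply: (irr_sorted_eq ltn_trans ltnn).
- exact: chain_orders_sorted.
- by apply: sorted_filter => //; apply: ltn_trans.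
move=> n; rewrite mem_filter andb_idr // => /(chain_orders_dvd mu_fuzzy).
by rewrite card_V4; case: n => [|[|[|[|[|n]]]]] // /dvdn_leq; case: n.
Qed.

Lemma V4_chain_ordersE mu eta : fuzzy_subgroup mu -> fuzzy_subgroup eta ->
    (1%N \in chain_orders mu) = (1%N \in chain_orders eta) ->
    (2%N \in chain_orders mu) = (2%N \in chain_orders eta) ->
  chain_orders mu = chain_orders eta.
Proof.
move=> mu_fuzzy eta_fuzzy e1 e2.
rewrite (V4_chain_orders mu_fuzzy) (V4_chain_orders eta_fuzzy) /= e1 e2.
by rewrite -card_V4 !card_in_chain_orders.
Qed.

(** A single [h] serves the whole chain, since at most one term has order 2. *)
Lemma V4_level_chain mu : fuzzy_subgroup mu ->
  exists2 h, h != 1%g & level_chain mu = [seq V4_subgroup h n | n <- chain_orders mu].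
Proof.
move=> mu_fuzzy.
have [h h1 hP] : exists2 h : V4, h != 1%g &
    forall H, H \in level_chain mu -> #|H| = 2%N -> H = [set 1%g; h]%SET.
  have [/mapP[H HC H2]|no2] := boolP (2%N \in chain_orders mu); last first.
    (* Without a term of order 2, any nontrivial element would do. *)
    exists (0, 1) => // H HC H2; case/negP: no2.
    by have := map_f (fun H : {set V4} => #|H|) HC; rewrite /= H2.
  have [h h1 HE] := V4_order2 (level_chain_group mu_fuzzy HC) (esym H2).
  by exists h => // K KC K2; rewrite -HE; apply: (level_chain_card_inj KC HC); exact: etrans K2 H2.
exists h => //; rewrite /chain_orders -map_comp -[LHS]map_id.
apply/eq_in_map => H HC /=; rewrite /V4_subgroup.
have gH := level_chain_group mu_fuzzy HC.
have H_dvd : (#|H| %| 4)%N by rewrite -card_V4 (chain_orders_dvd mu_fuzzy) // map_f.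
case: eqP => [H1|H1]; first exact: (card1_trivg (G := Group gH) H1).
case: eqP => [H2|H2]; first exact: hP.
apply/eqP; rewrite eqEcard finset.subsetT cardsT card_V4 /=.
by move: H_dvd H1 H2; case: #|_| => [|[|[|[|]]]].
Qed.

Lemma V4_fuzzy_approxP mu eta : fuzzy_subgroup mu -> fuzzy_subgroup eta ->
  fuzzy_approx mu eta <-> chain_orders mu = chain_orders eta.
Proof.
move=> mu_fuzzy eta_fuzzy; split=> [|eq_orders]; first exact: fuzzy_approx_orders.
have [h h1 muE] := V4_level_chain mu_fuzzy.
have [k k1 etaE] := V4_level_chain eta_fuzzy.
(* Exchanging the two generators carries each term of the chain of [eta] to the term of the same
   order in the chain of [mu]. *)
exists (tperm k h); first exact: V4_swap_Aut.
by rewrite muE etaE eq_orders -map_comp; apply: eq_map => n /=; apply: V4_subgroup_swap.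
Qed.

(** Ranks 0, 1, 2 suffice, as a chain has at most three terms; halving puts them in the unit
    interval. *)
Definition rank_fuzzy (k : V4 -> nat) (x : V4) : R := (k x)%:R / 2.

Lemma rank_fuzzy_le k x y : (rank_fuzzy k x <= rank_fuzzy k y) = (k x <= k y)%N.
Proof. by rewrite ler_pM2r ?invr_gt0 ?ltr0n // ler_nat. Qed.

Lemma rank_fuzzy_subgroup k : (forall x, (k x <= 2)%N) ->
    (forall x y, (minn (k x) (k y) <= k (x * y)%g)%N) ->
  fuzzy_subgroup (rank_fuzzy k).
Proof.
move=> k2 kM; split=> [x|x y|x].
- rewrite divr_ge0 ?ler0n //= ler_pdivrMr ?ltr0n // mul1r.
  by rewrite (ler_nat R _ 2).
- by rewrite ge_min !rank_fuzzy_le -geq_min.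
(* Every element of the group is its own inverse. *)
- suff -> : x^-1%g = x by [].
  apply/eqP; move: x (mem_V4_elements x); exact/allP.
Qed.

(** The right-hand side involves no real numbers and can be evaluated for each model. *)
Lemma rank_fuzzy_orders k n : (n \in chain_orders (rank_fuzzy k)) =
  has (fun x => count (fun y => k x <= k y)%N V4_elements == n) V4_elements.
Proof.
apply/chain_ordersP/hasP => -[x]; last move=> _.
  move=> <-; exists x; rewrite ?mem_V4_elements // card_V4_set.
  by apply/eqP/eq_count => y; rewrite /= inE rank_fuzzy_le.
move=> /eqP <-; exists x; rewrite card_V4_set.
by apply: eq_count => y; rewrite /= inE rank_fuzzy_le.
Qed.

(** For [n] = 0, 1, 2, 3 the level chains of [model n] are G, 1 < G, H < G
    and 1 < H < G, where H is generated by (0, 1). *)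
Definition model_rank (n : nat) (x : V4) : nat :=
  if x == 1%g then nth 0%N [:: 0; 2; 2; 2]%N n
  else if x == (0, 1) then nth 0%N [:: 0; 0; 2; 1]%N n else 0%N.

Definition model (n : nat) : V4 -> R := rank_fuzzy (model_rank n).

Lemma model_fuzzy n : (n < 4)%N -> fuzzy_subgroup (model n).
Proof.
move=> n4; apply: rank_fuzzy_subgroup => [x|x y].
  by move: n n4 x (mem_V4_elements x) => [|[|[|[|//]]]] _; apply/allP.
have : all (fun n => all (fun x => all (fun y =>
    (minn (model_rank n x) (model_rank n y) <= model_rank n (x * y)%g)%N)
    V4_elements) V4_elements) (iota 0 4) by [].
move=> /allP/(_ n); rewrite mem_iota => /(_ n4).
by move=> /allP/(_ x (mem_V4_elements x))/allP/(_ y (mem_V4_elements y)).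
Qed.

(** The index of a model is a two-digit binary code: the low digit records a term of order 1, the
    high digit a term of order 2. *)
Lemma model_orders1 n : (n < 4)%N -> (1%N \in chain_orders (model n)) = odd n.
Proof. by rewrite rank_fuzzy_orders; case: n => [|[|[|[|]]]]. Qed.

Lemma model_orders2 n : (n < 4)%N -> (2%N \in chain_orders (model n)) = (1 < n)%N.
Proof. by rewrite rank_fuzzy_orders; case: n => [|[|[|[|]]]]. Qed.

Lemma fuzzy_classE mu eta : fuzzy_subgroup eta ->
  fuzzy_class mu = fuzzy_class eta <-> fuzzy_approx mu eta.
Proof.
move=> eta_fuzzy; split=> [eq_class|mu_eta].
  have : fuzzy_class eta eta by split=> //; exact: fuzzy_approx_refl.
  by rewrite -eq_class => -[].
apply/seteqP; split=> nu [nu_fuzzy nuA]; split=> //.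
  exact: fuzzy_approx_trans (fuzzy_approx_sym mu_eta) nuA.
exact: fuzzy_approx_trans mu_eta nuA.
Qed.

Lemma V4_fuzzy_classes_model :
  fuzzy_classes R V4 = [set fuzzy_class (model n) | n in `I_4].
Proof.
apply/seteqP; split=> [_ [mu mu_fuzzy <-]|_ [n /= n4 <-]]; last first.
  by exists (model n) => //; apply: model_fuzzy.
(* The binary code of [mu] selects the model with the same orders. *)
pose n := ((1%N \in chain_orders mu) + (2%N \in chain_orders mu).*2)%N.
have n4 : (n < 4)%N by rewrite /n; do 2!case: (_ \in _).
have n_fuzzy := model_fuzzy n4.
exists n => //; apply/fuzzy_classE => //; apply/V4_fuzzy_approxP => //.
by apply: V4_chain_ordersE => //; rewrite (model_orders1, model_orders2) // /n;
  do 2!case: (_ \in _).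
Qed.

(** The orders are constant on a class, and both binary digits of the index are read off from
    them. *)
Lemma model_class_inj : {in `I_4 &, injective (fun n => fuzzy_class (model n))}.
Proof.
move=> m n; rewrite !inE /= => m4 n4.
move=> /(fuzzy_classE _ (model_fuzzy n4))/fuzzy_approx_orders eq_orders.
have := model_orders1 m4; have := model_orders2 m4.
rewrite eq_orders model_orders1 // model_orders2 // => {eq_orders}.
by case: m m4 => [|[|[|[|]]]] //; case: n n4 => [|[|[|[|]]]].
Qed.

End V4FuzzySubgroups.

Theorem theorem4p2p1 (R : realType) :
  exists N : nat,
    [/\ fuzzy_classes R ('Z_2 * 'Z_2)%type #= `I_N,
        N%:R = 1 / 6 * (8 + 3 * 4 + 2 * 2) :> rat
      & N = 4%N].
Proof.
exists 4%N; split=> //; rewrite V4_fuzzy_classes_model.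
exact: inj_card_eq (@model_class_inj R).
Qed.
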